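(* For any $\varepsilon>0$ there exist a smooth Jordan curve $\Gamma$ in $\mathbb{R}^2$ bounding a Jordan domain $\Omega$ and a smooth function $u:\mathbb{R}^2\to\mathbb{R}$ satisfying $\Delta u+e^{2u}\le 0$ on $\mathbb{R}^2$, such that $\int_{\mathbb{R}^2}e^{2u}<\infty$ and $$\left(\int_\Gamma e^u\right)^2\le\varepsilon\cdot\int_\Omega e^{2u}\cdot\int_{\mathbb{R}^2\setminus\Omega}e^{2u}.$$
   Context: Here $\Delta=\partial_x^2+\partial_y^2$ is the Euclidean Laplacian; the integral over $\Gamma$ is with respect to Euclidean arc length and the integrals over planar sets are with respect to Lebesgue measure. The Jordan domain $\Omega$ is the bounded component of $\mathbb{R}^2\setminus\Gamma$. *)

(* Defs.v *)
From HB Require Import structures.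
From mathcomp Require Import all_boot all_order all_algebra.
From mathcomp Require Import all_classical all_reals all_analysis.

Set Implicit Arguments.
Unset Strict Implicit.
Unset Printing Implicit Defensive.

Import Order.TTheory GRing.Theory Num.Theory.
Import numFieldNormedType.Exports.

Local Open Scope classical_set_scope.
Local Open Scope ring_scope.

Definition dx (R : realType) (u : R * R -> R) : R * R -> R :=
  fun p => 'D_((1, 0) : R * R) u p.

Definition dy (R : realType) (u : R * R -> R) : R * R -> R :=
  fun p => 'D_((0, 1) : R * R) u p.

(* Class C^k in the classical sense: every partial derivative of order at most
   k exists on the whole plane and is continuous. *)
Fixpoint Ck (R : realType) (k : nat) (u : R * R -> R) : Prop :=
  continuous u /\
  match k with
  | 0 => True
  | k'.+1 =>
      [/\ forall p, derivable u p ((1, 0) : R * R),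
          forall p, derivable u p ((0, 1) : R * R),
          Ck k' (dx u) & Ck k' (dy u)]
  end.

Definition smooth (R : realType) (u : R * R -> R) : Prop := forall k, Ck k u.

Definition laplacian (R : realType) (u : R * R -> R) : R * R -> R :=
  fun p => dx (dx u) p + dy (dy u) p.

(* The library norm on R * R is the sup norm, so the Euclidean one is written
   out here. *)
Definition euclidean_norm (R : realType) (v : R * R) : R :=
  Num.sqrt (v.1 ^+ 2 + v.2 ^+ 2).

(* Regular smooth 1-periodic parametrization of a simple closed curve; a smooth
   Jordan curve is the image of such a map. *)
Definition smooth_jordan_param (R : realType) (gamma : R -> R * R) : Prop :=
  [/\ forall n t, derivable (derive1n n gamma) t 1,
      forall t, gamma (t + 1) = gamma t,
      {in `[0, 1[ &, injective gamma} &
      forall t, derive1 gamma t != 0].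

(* By the Jordan curve theorem, a Jordan curve has exactly one such component. *)
Definition bounded_component (R : realType) (Gamma Omega : set (R * R)) : Prop :=
  bounded_set Omega /\
  exists2 p, (~` Gamma) p & Omega = connected_component (~` Gamma) p.

(* Integral of f with respect to Euclidean arc length over the closed curve
   parametrized once by gamma on [0, 1]. *)
Definition arc_integral (R : realType) (gamma : R -> R * R) (f : R * R -> R) :
    \bar R :=
  (\int[@lebesgue_measure R]_(t in `[0%R, 1%R])
     (f (gamma t) * euclidean_norm (derive1 gamma t))%:E)%E.

Definition area_integral (R : realType) (D : set (R * R)) (f : R * R -> R) :
    \bar R :=
  (\int[@lebesgue_measure R \x @lebesgue_measure R]_(p in D) (f p)%:E)%E.

(* Main.v *)
(* Take u = - (a x^2 + y^2) with 0 < a <= 1 and the unit circle for Gamma. Then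
   Delta u = - 2 a - 2 <= - 1 <= - e^{2u}, the length of Gamma is at most 2 pi
   and the area of the disk is bounded below independently of a, whereas the area
   outside the disk tends to infinity as a tends to 0, because the Gaussian
   e^{2u} spreads out along the x-axis. *)

Require Import Defs.
From HB Require Import structures.
From mathcomp Require Import all_boot all_order all_algebra.
From mathcomp Require Import all_classical all_reals all_analysis.
From mathcomp Require Import measurable_realfun ring lra.

Set Implicit Arguments.
Unset Strict Implicit.
Unset Printing Implicit Defensive.

Import Order.TTheory GRing.Theory Num.Theory.
Import numFieldNormedType.Exports.

Local Open Scope classical_set_scope.
Local Open Scope ring_scope.

(** * Derivatives of quadratic polynomials in the plane *)

Lemma is_derive_fst (R : realType) (p v : R * R) :
  is_derive p v (fst : R * R -> R) v.1.
Proof.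
have lin : (fun h : R => h^-1 *: ((h *: v + p).1 - p.1)) @ 0^' --> v.1.
  (* The difference quotient of a linear map is constant away from [h = 0]. *)
  apply: (@cvg_trans _ (cst v.1 @ (0 : R)^')); last exact: cvg_cst.
  apply: near_eq_cvg; near=> h; rewrite /= addrK scalerA mulVf ?scale1r//.
  by near: h; exact: nbhs_dnbhs_neq.
by apply: DeriveDef; [apply: cvgP lin|apply/cvg_lim].
Unshelve. all: by end_near. Qed.

Lemma is_derive_snd (R : realType) (p v : R * R) :
  is_derive p v (snd : R * R -> R) v.2.
Proof.
have lin : (fun h : R => h^-1 *: ((h *: v + p).2 - p.2)) @ 0^' --> v.2.
  apply: (@cvg_trans _ (cst v.2 @ (0 : R)^')); last exact: cvg_cst.
  apply: near_eq_cvg; near=> h; rewrite /= addrK scalerA mulVf ?scale1r//.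
  by near: h; exact: nbhs_dnbhs_neq.
by apply: DeriveDef; [apply: cvgP lin|apply/cvg_lim].
Unshelve. all: by end_near. Qed.

(** The linear and constant terms are carried along so that the family is closed under [dx] and
    [dy]. *)
Definition diag_quadratic (R : realType) (a b c d e : R) : R * R -> R :=
  fun p => a * p.1 ^+ 2 + b * p.2 ^+ 2 + c * p.1 + d * p.2 + e.

Section diag_quadratic.
Variable R : realType.
Implicit Types (a b c d e : R) (p v : R * R).

Lemma is_derive_diag_quadratic a b c d e p v :
  is_derive p v (diag_quadratic a b c d e)
    ((2 * a * p.1 + c) * v.1 + (2 * b * p.2 + d) * v.2).
Proof.
have -> : diag_quadratic a b c d e =
    (a \*: ((fst : R * R -> R) ^+ 2)) + (b \*: ((snd : R * R -> R) ^+ 2)) +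
    (c \*: (fst : R * R -> R)) + (d \*: (snd : R * R -> R)) + cst e.
  by apply/funext => q.
have D1 := is_derive_fst p v; have D2 := is_derive_snd p v.
by apply: is_derive_eq; rewrite /GRing.scale/= !expr1; ring.
Qed.

Lemma dx_diag_quadratic a b c d e :
  dx (diag_quadratic a b c d e) = diag_quadratic 0 0 (2 * a) 0 c.
Proof.
apply/funext => p; rewrite /dx.
rewrite (@derive_val _ _ _ _ _ _ _ (is_derive_diag_quadratic a b c d e p _)).
by rewrite /diag_quadratic /=; ring.
Qed.

Lemma dy_diag_quadratic a b c d e :
  dy (diag_quadratic a b c d e) = diag_quadratic 0 0 0 (2 * b) d.
Proof.
apply/funext => p; rewrite /dy.
rewrite (@derive_val _ _ _ _ _ _ _ (is_derive_diag_quadratic a b c d e p _)).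
by rewrite /diag_quadratic /=; ring.
Qed.

Lemma continuous_diag_quadratic a b c d e :
  continuous (diag_quadratic a b c d e).
Proof.
move=> p; have C1 : {for p, continuous (fst : R * R -> R)} by exact: cvg_fst.
have C2 : {for p, continuous (snd : R * R -> R)} by exact: cvg_snd.
apply: cvgD; last exact: cvg_cst.
by repeat apply: cvgD; apply: cvgM => //; try exact: cvg_cst; exact: cvgM.
Qed.

(** Induction on the order, for all coefficients at once: both partial derivatives stay in the
    family, with other coefficients. *)
Lemma smooth_diag_quadratic a b c d e : smooth (diag_quadratic a b c d e).
Proof.
move=> k; elim: k a b c d e => [|k IHk] a b c d e; split => //;
  try exact: continuous_diag_quadratic.
split=> [p|p||].
- exact: (@ex_derive _ _ _ _ _ _ _ (is_derive_diag_quadratic _ _ _ _ _ _ _)).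
- exact: (@ex_derive _ _ _ _ _ _ _ (is_derive_diag_quadratic _ _ _ _ _ _ _)).
- by rewrite dx_diag_quadratic.
- by rewrite dy_diag_quadratic.
Qed.

Lemma laplacian_diag_quadratic a b c d e p :
  laplacian (diag_quadratic a b c d e) p = 2 * a + 2 * b.
Proof.
rewrite /laplacian !(dx_diag_quadratic, dy_diag_quadratic).
by rewrite /diag_quadratic; ring.
Qed.

End diag_quadratic.

(** * The unit circle and the disk it bounds *)

Definition circle (R : realType) (r w phi : R) : R -> R * R :=
  fun t => (r * cos (w * t + phi), r * sin (w * t + phi)).

Section circle.
Variable R : realType.
Implicit Types (r w phi t : R) (p q : R * R).

Lemma is_derive_pair (V : normedModType R) (f g : V -> R) (t v : V)
    (df dg : R) :
  is_derive t v f df -> is_derive t v g dg ->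
  is_derive t v (fun s => (f s, g s) : R * R) (df, dg).
Proof.
move=> [cf <-] [cg <-].
have fgD : (fun h : R => h^-1 *:
      ((f (h *: v + t), g (h *: v + t)) - (f t, g t) : R * R))
    @ 0^' --> ('D_v f t, 'D_v g t).
  exact: (cvg_pair cf cg).
by apply: DeriveDef; [apply: cvgP fgD|apply/cvg_lim].
Qed.

(** Differentiation scales by [w] and turns by a quarter circle. The phase [phi] absorbs the turn,
    so all iterated derivatives remain of the form [circle]. *)
Lemma is_derive_circle r w phi t :
  is_derive t 1 (circle r w phi) (circle (r * w) w (phi + pi / 2) t).
Proof.
have D : is_derive t 1 (fun s => w * s + phi) w.
  have -> : (fun s => w * s + phi) = w \*: id + cst phi by [].
  by apply: is_derive_eq; rewrite /GRing.scale/=; ring.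
apply: is_derive_pair.
- have -> : (fun s => r * cos (w * s + phi)) =
    r \*: (cos \o (fun s => w * s + phi)) by [].
  by apply: is_derive_eq; rewrite /GRing.scale/= addrA cosDpihalf; ring.
- have -> : (fun s => r * sin (w * s + phi)) =
    r \*: (sin \o (fun s => w * s + phi)) by [].
  by apply: is_derive_eq; rewrite /GRing.scale/= addrA sinDpihalf; ring.
Qed.

Lemma derive1_circle r w phi :
  derive1 (circle r w phi) = circle (r * w) w (phi + pi / 2).
Proof.
apply/funext => t.
by rewrite derive1E (@derive_val _ _ _ _ _ _ _ (is_derive_circle r w phi t)).
Qed.

Lemma derive1n_circle n r w phi : exists r' phi',
  derive1n n (circle r w phi) = circle r' w phi'.
Proof.
elim: n => [|n [r' [phi' IHn]]]; first by exists r, phi.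
by exists (r' * w), (phi' + pi / 2); rewrite derive1nS IHn derive1_circle.
Qed.

Lemma euclidean_norm_circle r w phi t :
  euclidean_norm (circle r w phi t) = `|r|.
Proof.
by rewrite /euclidean_norm /= !exprMn -mulrDr cos2Dsin2 mulr1 sqrtr_sqr.
Qed.

Lemma sin_eq0_itv (x : R) : - pi < x < pi -> sin x = 0 :> R -> x = 0.
Proof.
move=> /andP[x1 x2] s0; case: (ltgtP x 0) => // x0.
- have : 0 < sin (- x) by apply: sin_gt0_pi; rewrite oppr_gt0 x0 ltrNl.
  by rewrite sinN s0 oppr0 ltxx.
- have : 0 < sin x by apply: sin_gt0_pi; rewrite x0.
  by rewrite s0 ltxx.
Qed.

(** Since cos x = 1 - 2 sin^2 (x/2), the sine of x/2 vanishes, and x/2 lies strictly between -pi and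
    pi. *)
Lemma cos_eq1_itv (x : R) : - (pi *+ 2) < x < pi *+ 2 -> cos x = 1 :> R -> x = 0.
Proof.
move=> xpi; have {1}-> : x = (x / 2) *+ 2 by rewrite mulr2n; field.
rewrite cos_mulr2n cos2sin2 => h.
have /sin_eq0_itv : sin (x / 2) = 0.
  by apply/eqP; rewrite -sqrf_eq0; apply/eqP; move: h; rewrite !mulr2n; lra.
move: xpi; rewrite (mulr2n pi) => /andP[x1 x2] h2.
have x20 : x / 2 = 0 by apply: h2; apply/andP; split; lra.
lra.
Qed.

(** If two parameters have the same image, the cosine of the difference of their angles is cos^2 +
    sin^2 = 1. That difference is less than a full turn, as |s - t| < 1. *)
Lemma inj_unit_circle : {in `[0, 1[ &, injective (circle 1 (pi *+ 2 : R) 0)}.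
Proof.
move=> s t; rewrite !in_itv/= => /andP[s0 s1] /andP[t0 t1].
rewrite /circle !mul1r !addr0 => -[hc hs].
have pi0 := @pi_gt0 R.
have : cos (pi *+ 2 * s - pi *+ 2 * t) = 1.
  by rewrite cosB hc hs -!expr2 cos2Dsin2.
move/cos_eq1_itv; rewrite -mulrBr => h.
have /eqP : pi *+ 2 * (s - t) = 0.
  apply: h; have : 0 < pi *+ 2 :> R by rewrite mulrn_wgt0.
  by move: (pi *+ 2) => T T0; apply/andP; split; nra.
by rewrite mulf_eq0 mulrn_eq0/= gt_eqF//= subr_eq0 => /eqP.
Qed.

Lemma smooth_jordan_unit_circle : smooth_jordan_param (circle 1 (pi *+ 2 : R) 0).
Proof.
split.
- by move=> n t; have [r' [phi' ->]] := derive1n_circle n 1 (pi *+ 2) 0;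
    exact: (@ex_derive _ _ _ _ _ _ _ (is_derive_circle _ _ _ _)).
- by move=> t; rewrite /circle mulrDr mulr1 !addr0 cosD2pi sinD2pi.
- exact: inj_unit_circle.
(* The speed is constantly [pi *+ 2], whereas the zero vector has norm 0. *)
- move=> t; apply/eqP => /(congr1 (@euclidean_norm R)).
  rewrite derive1_circle euclidean_norm_circle mul1r.
  rewrite /euclidean_norm/= expr0n/= addr0 sqrtr0 => /normr0P.
  by rewrite mulrn_eq0/= gt_eqF// pi_gt0.
Qed.

Lemma range_unit_circle :
  range (circle 1 (pi *+ 2 : R) 0) = [set p | p.1 ^+ 2 + p.2 ^+ 2 = 1].
Proof.
apply/seteqP; split => [_ [t _ <-]|[x y]/= xy].
  by rewrite /circle/= !mul1r cos2Dsin2.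
suff [z [zx zy]] : exists z, cos z = x /\ sin z = y.
  exists (z / (pi *+ 2)) => //.
  rewrite /circle !mul1r addr0 mulrCA divff ?mulr1 ?zx ?zy//.
  by rewrite mulrn_eq0/= gt_eqF// pi_gt0.
have x1 : -1 <= x <= 1.
  by rewrite -ler_norml -(@expr_le1 _ 2)// real_normK ?num_real// -xy lerDl sqr_ge0.
(* [acos x] is the right angle on the upper half circle; on the lower half its opposite is. *)
have sE : sin (acos x) = `|y|.
  by rewrite sin_acos// -xy [X in X - _]addrC addrK sqrtr_sqr.
have [y0|y0] := leP 0 y.
- by exists (acos x); rewrite acosK// sE ger0_norm.
- by exists (- acos x); rewrite cosN sinN acosK// sE ltr0_norm// opprK.
Qed.

Definition unit_disk : set (R * R) := [set p | p.1 ^+ 2 + p.2 ^+ 2 < 1].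

Lemma continuous_sumsq : continuous (fun p => p.1 ^+ 2 + p.2 ^+ 2 : R).
Proof.
move=> p; have C1 : {for p, continuous (fst : R * R -> R)} by exact: cvg_fst.
have C2 : {for p, continuous (snd : R * R -> R)} by exact: cvg_snd.
by apply: cvgD; apply: cvgM.
Qed.

(** Radial segments join the origin to each point of the disk without meeting the circle.
    Conversely, a connected set that avoids the circle and contains the origin cannot leave the
    disk, by the intermediate value property of x^2 + y^2. *)
Lemma bounded_component_unit_disk :
  bounded_component [set p | p.1 ^+ 2 + p.2 ^+ 2 = 1 :> R] unit_disk.
Proof.
split.
  (* Boundedness refers to the sup norm, so each coordinate is bounded separately. *)
  exists 1; split => // M M1 [x y] /= xy.
  have sq1 (z : R) : z ^+ 2 < 1 -> `|z| <= M.
    move=> z1; apply: le_trans (ltW M1).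
    by rewrite -(@expr_le1 _ 2)// real_normK ?num_real// ltW.
  have := sqr_ge0 x; have := sqr_ge0 y; move=> y0 x0.
  rewrite /unit_disk/= in xy.
  by rewrite ge_max; apply/andP; split; apply: sq1 => /=; lra.
exists 0.
  by rewrite /= !expr0n/= addr0 => /esym/eqP; rewrite oner_eq0.
apply/seteqP; split => [p pD|p [C [C0 CG cC] Cp]].
  apply: (@connected_component_max _ _ ((fun t : R => t *: p) @` `[0, 1]%classic)).
  - by exists 0; rewrite ?scale0r//= in_itv/= lexx ler01.
  - move=> _ [t /= + <-]; rewrite in_itv/= => /andP[t0 t1].
    rewrite !exprMn -mulrDr => h.
    have : t ^+ 2 * (p.1 ^+ 2 + p.2 ^+ 2) < 1; last by rewrite h ltxx.
    apply: le_lt_trans pD; apply: ler_piMl; rewrite ?exprn_ile1//.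
    by rewrite addr_ge0 ?sqr_ge0.
  - apply: connected_continuous_connected; first exact: segment_connected.
    by apply: continuous_subspaceT => t; exact: scalel_continuous.
  - by exists 1; rewrite ?scale1r//= in_itv/= lexx ler01.
rewrite /unit_disk/= ltNge; apply/negP => p1.
(* This image is an interval containing 0 and a value at least 1, hence 1 itself: [C] would meet the
   circle. *)
have : connected ((fun q : R * R => q.1 ^+ 2 + q.2 ^+ 2) @` C).
  apply: connected_continuous_connected => //.
  exact/continuous_subspaceT/continuous_sumsq.
move/connected_intervalP => /(_ 0 (p.1 ^+ 2 + p.2 ^+ 2)) h.
have [|||q Cq q1] := h _ _ 1.
- by exists 0 => //=; rewrite expr0n/= addr0.
- by exists p.
- by rewrite ler01.
- exact: (CG q Cq).
Qed.

End circle.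

(** * Gaussian integrals and general bounds for area and arc integrals *)

Lemma measurable_gaussian (R : realType) (c : R) :
  measurable_fun setT (fun x : R => expR (- (c * x ^+ 2))).
Proof.
apply: measurableT_comp => //; apply: measurableT_comp => //.
by apply: measurable_funM.
Qed.

Section areas.
Variable R : realType.
Local Notation mu := (@lebesgue_measure R).

(** Up to a positive factor the integrand is the centred normal density with standard deviation
    1/sqrt(2c), whose integral is 1. *)
Lemma gauss_area_lty (c : R) : 0 < c ->
  (\int[mu]_x (expR (- (c * x ^+ 2)))%:E < +oo)%E.
Proof.
move=> c0; pose s := (Num.sqrt (2 * c))^-1.
have s0 : s != 0 by rewrite invr_eq0 gt_eqF// sqrtr_gt0 mulr_gt0.
have sE : s ^+ 2 *+ 2 = c^-1.
  rewrite /s exprVn sqr_sqrtr ?mulr_ge0 ?ltW// -mulr_natr.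
  by field; rewrite gt_eqF.
have := integral_normal_pdf (0 : R) s; rewrite normal_pdfE//.
under eq_integral do
  rewrite /normal_fun subr0 sE invrK mulNr [_ * c]mulrC EFinM.
rewrite ge0_integralZl//=; first last.
- by rewrite lee_fin ltW// normal_peak_gt0.
- by apply/measurable_EFinP; exact: measurable_gaussian.
have : (0 <= \int[mu]_x (expR (- (c * x ^+ 2)))%:E)%E.
  by apply: integral_ge0 => x _; rewrite lee_fin expR_ge0.
(* The value +oo would make the total mass of the density infinite instead of 1; -oo is excluded by
   nonnegativity. *)
case: (\int[mu]_x _)%E => [r _ _| _|//]; first by rewrite ltry.
by rewrite gt0_muley// lte_fin normal_peak_gt0.
Qed.

(** By Tonelli the integral is the product of the two one-dimensional integrals. *)
Lemma area_integral_tensor_lty (f g : R -> R) :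
  measurable_fun setT f -> measurable_fun setT g ->
  (forall x, 0 <= f x) -> (forall x, 0 <= g x) ->
  (\int[mu]_x (f x)%:E < +oo)%E -> (\int[mu]_x (g x)%:E < +oo)%E ->
  (area_integral setT (fun p => f p.1 * g p.2)%R < +oo)%E.
Proof.
move=> mf mg f0 g0 If Ig; rewrite /area_integral fubini_tonelli1; first last.
- by move=> p; rewrite lee_fin mulr_ge0.
- apply/measurable_EFinP; apply: measurable_funM;
    exact: measurableT_comp.
rewrite /fubini_F/=.
have Ig0 : (0 <= \int[mu]_x (g x)%:E)%E.
  by apply: integral_ge0 => x _; rewrite lee_fin.
have If0 : (0 <= \int[mu]_x (f x)%:E)%E.
  by apply: integral_ge0 => x _; rewrite lee_fin.
have inner x : (\int[mu]_y (f x * g y)%:E = (f x)%:E * \int[mu]_y (g y)%:E)%E.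
  under eq_integral do rewrite EFinM.
  rewrite ge0_integralZl ?lee_fin//=; first exact/measurable_EFinP.
  by move=> y _; rewrite lee_fin.
under eq_integral do rewrite inner.
rewrite ge0_integralZr//=; first last.
- by move=> y _; rewrite lee_fin.
- exact/measurable_EFinP.
by rewrite lte_mul_pinfty// ge0_fin_numE.
Qed.

Lemma lebesgue_measure_segment (x y : R) : x <= y ->
  mu `[x, y]%classic = (y - x)%:E.
Proof.
rewrite lebesgue_measure_itv/= lte_fin le_eqVlt => /predU1P[->|->//].
by rewrite ltxx subrr.
Qed.

(** Restrict the nonnegative integrand to the rectangle, then replace it there by the constant [m].
    Both lower bounds on areas, inside and outside the disk, come from this. *)
Lemma area_integral_ge_rectangle (D : set (R * R)) (f : R * R -> R)
    (a b c d m : R) :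
  a <= b -> c <= d -> 0 <= m ->
  measurable D -> measurable_fun D f -> (forall p, D p -> 0 <= f p) ->
  `[a, b] `*` `[c, d] `<=` D ->
  (forall p, (`[a, b] `*` `[c, d]) p -> m <= f p) ->
  ((m * ((b - a) * (d - c)))%:E <= area_integral D f)%E.
Proof.
move=> ab cd m0 mD mf f0 sub fm; rewrite /area_integral.
have mS : measurable (`[a, b] `*` `[c, d] : set (R * R)) by exact: measurableX.
apply: (@le_trans _ _ (\int[mu \x mu]_(p in `[a, b] `*` `[c, d]) (f p)%:E)%E);
  last first.
  apply: ge0_subset_integral => //; exact/measurable_EFinP.
apply: (@le_trans _ _ (\int[mu \x mu]_(p in `[a, b] `*` `[c, d]) (cst m%:E p))%E).
  have muS : ((mu \x mu) (`[a, b] `*` `[c, d]) = ((b - a) * (d - c))%:E)%E.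
    rewrite EFinM -!lebesgue_measure_segment//.
    exact: (@product_measure1E _ _ _ _ _ mu mu).
  by rewrite integral_cst// EFinM -muS.
by apply: ge0_le_integral => //; apply/measurable_EFinP; exact: measurable_funS mf.
Qed.

(** The parameter interval has length 1, so a pointwise bound on the integrand also bounds the
    integral. *)
Lemma arc_integral_le (gamma : R -> R * R) (f : R * R -> R) (M : R) :
  measurable_fun setT
    (fun t : R => f (gamma t) * euclidean_norm (derive1 gamma t)) ->
  (forall t, 0 <= f (gamma t)) ->
  (forall t, f (gamma t) * euclidean_norm (derive1 gamma t) <= M) ->
  (arc_integral gamma f <= M%:E)%E.
Proof.
move=> mf f0 fM; rewrite /arc_integral.
have g0 t : 0 <= f (gamma t) * euclidean_norm (derive1 gamma t).
  by rewrite mulr_ge0// sqrtr_ge0.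
apply: (@le_trans _ _ (\int[mu]_(t in `[0%R, 1%R]) (cst M%:E t))%E).
  apply: ge0_le_integral => //.
  - by move=> t _; rewrite lee_fin.
  - exact/measurable_EFinP/measurable_funTS.
  - by move=> t _; rewrite /= lee_fin fM.
have mu01 : mu `[0, 1]%classic = 1%E.
  by rewrite lebesgue_measure_segment// subr0.
by rewrite integral_cst// -[leRHS]mule1 -mu01.
Qed.

End areas.

Lemma measurable_sumsq (R : realType) :
  measurable_fun setT (fun p : R * R => p.1 ^+ 2 + p.2 ^+ 2).
Proof. by apply: measurable_funD; apply: measurable_funX. Qed.

Lemma measurable_unit_disk (R : realType) : measurable (@unit_disk R).
Proof.
rewrite [X in measurable X](_ : _ =
  setT `&` (fun p : R * R => p.1 ^+ 2 + p.2 ^+ 2) @^-1` `]-oo, 1[%classic).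
  by apply: measurable_sumsq => //; exact: measurable_itv.
by rewrite setTI; apply/seteqP; split => p; rewrite /unit_disk/= in_itv.
Qed.

(** * The function u: differential inequality, areas and length *)

Definition log_conformal_factor (R : realType) (a : R) : R * R -> R :=
  diag_quadratic (- a) (-1) 0 0 0.

Section conformal_factor.
Variables (R : realType) (a : R).
Hypotheses (a_gt0 : 0 < a) (a_le1 : a <= 1).

Local Notation u := (log_conformal_factor a).

Lemma log_conformal_factorE p : u p = - (a * p.1 ^+ 2 + p.2 ^+ 2).
Proof. by rewrite /log_conformal_factor /diag_quadratic; ring. Qed.

Lemma log_conformal_factor_le0 p : u p <= 0.
Proof.
rewrite log_conformal_factorE oppr_le0; apply: addr_ge0; last exact: sqr_ge0.
by apply: mulr_ge0; [exact: ltW|exact: sqr_ge0].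
Qed.

Lemma laplacian_log_conformal_factor p : laplacian u p + expR (2 * u p) <= 0.
Proof.
rewrite laplacian_diag_quadratic.
have : expR (2 * u p) <= 1.
  by rewrite -expR0 ler_expR pmulr_rle0// log_conformal_factor_le0.
by move: (expR _) => e; have := a_gt0; lra.
Qed.

(** Separating the variables reduces measurability and finite total area to one-dimensional
    Gaussians. *)
Lemma expR_conformal_factor p :
  expR (2 * u p) = expR (- (2 * a * p.1 ^+ 2)) * expR (- (2 * p.2 ^+ 2)).
Proof. by rewrite log_conformal_factorE -expRD; congr expR; ring. Qed.

Lemma measurable_conformal_area :
  measurable_fun setT (fun p => expR (2 * u p)).
Proof.
rewrite (funext expR_conformal_factor).
apply: measurable_funM.
  exact: (measurableT_comp (measurable_gaussian (2 * a)) measurable_fst).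
exact: (measurableT_comp (measurable_gaussian 2) measurable_snd).
Qed.

Lemma conformal_area_lty :
  (area_integral setT (fun p => expR (2 * u p)) < +oo)%E.
Proof.
rewrite (funext expR_conformal_factor).
apply: (@area_integral_tensor_lty _ (fun x => expR (- (2 * a * x ^+ 2)))
  (fun y => expR (- (2 * y ^+ 2)))).
- exact: measurable_gaussian.
- exact: measurable_gaussian.
- by move=> x; exact: expR_ge0.
- by move=> x; exact: expR_ge0.
- by apply: gauss_area_lty; rewrite mulr_gt0.
- exact: gauss_area_lty.
Qed.

(** The square [0, 1/2]^2 lies in the disk and has area 1/4. On it a x^2 + y^2 <= 1/2 because a <=
    1, so 2u >= -1. *)
Lemma conformal_area_unit_disk_ge :
  ((expR (-1) / 4)%:E <=
    area_integral (@unit_disk R) (fun p => expR (2 * u p)))%E.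
Proof.
rewrite (_ : expR (-1) / 4 = expR (-1) * ((2^-1 - 0) * (2^-1 - 0))); last by field.
apply: area_integral_ge_rectangle; rewrite ?invr_ge0 ?expR_ge0//.
- exact: measurable_unit_disk.
- exact: measurable_funS measurable_conformal_area.
- move=> [x y] []/=; rewrite !in_itv/= => /andP[x0 x1] /andP[y0 y1].
  by rewrite /unit_disk/=; nra.
- move=> [x y] []/=; rewrite !in_itv/= => /andP[x0 x1] /andP[y0 y1].
  rewrite ler_expR log_conformal_factorE/=.
  have x2 : x ^+ 2 <= 4^-1 by nra.
  have y2 : y ^+ 2 <= 4^-1 by nra.
  have : a * x ^+ 2 <= x ^+ 2 by rewrite ler_piMl ?sqr_ge0.
  by lra.
Qed.

(** The rectangle [2, 2 + K] x [0, 1] has area [K] and misses the disk since x >= 2. The condition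
    on [a] gives a x^2 <= 1 on it, and y^2 <= 1, so 2u >= -4. *)
Lemma conformal_area_exterior_ge (K : R) : 0 <= K -> a * (2 + K) ^+ 2 <= 1 ->
  ((expR (-4) * K)%:E <=
    area_integral (~` (@unit_disk R)) (fun p => expR (2 * u p)))%E.
Proof.
move=> K0 aK.
rewrite (_ : expR (-4) * K = expR (-4) * ((2 + K - 2) * (1 - 0))); last by ring.
apply: area_integral_ge_rectangle; rewrite ?lerDl ?expR_ge0//.
- by apply: measurableC; exact: measurable_unit_disk.
- exact: measurable_funS measurable_conformal_area.
- move=> [x y] []/=; rewrite !in_itv/= => /andP[x0 x1] /andP[y0 y1].
  by rewrite /unit_disk/=; apply/negP; rewrite -leNgt; nra.
- move=> [x y] []/=; rewrite !in_itv/= => /andP[x0 x1] /andP[y0 y1].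
  rewrite ler_expR log_conformal_factorE/=.
  have y2 : y ^+ 2 <= 1 by nra.
  have : a * x ^+ 2 <= a * (2 + K) ^+ 2.
    by rewrite ler_pM2l// ler_pXn2r ?nnegrE//; lra.
  by lra.
Qed.

Lemma conformal_length_unit_circle_le :
  (arc_integral (circle 1 (pi *+ 2) 0) (fun p => expR (u p)) <= (pi *+ 2)%:E)%E.
Proof.
have pi2_ge0 : 0 <= pi *+ 2 :> R by exact: mulrn_wge0 (pi_ge0 R).
have speed t : euclidean_norm (derive1 (circle 1 (pi *+ 2 : R) 0) t) = pi *+ 2.
  by rewrite derive1_circle euclidean_norm_circle mul1r ger0_norm.
apply: (@arc_integral_le R _ (fun p => expR (u p))) => [|t|t].
(* Measurability follows from continuity in the parameter, once the constant speed is
   substituted. *)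
- under eq_fun do rewrite speed log_conformal_factorE/= !mul1r !addr0.
  apply: continuous_measurable_fun => t.
  have L : {for t, continuous (fun s : R => pi *+ 2 * s)}.
    by apply: cvgM; [exact: cvg_cst|exact: cvg_id].
  have C : {for t, continuous (fun s : R => cos (pi *+ 2 * s))}.
    by apply: continuous_comp L _; exact: continuous_cos.
  have S : {for t, continuous (fun s : R => sin (pi *+ 2 * s))}.
    by apply: continuous_comp L _; exact: continuous_sin.
  have E : {for t, continuous (fun s : R =>
      - (a * cos (pi *+ 2 * s) ^+ 2 + sin (pi *+ 2 * s) ^+ 2))}.
    apply: cvgN; apply: cvgD; last exact: cvgM.
    by apply: cvgM; [exact: cvg_cst|exact: cvgM].
  apply: cvgM; last exact: cvg_cst.
  by apply: continuous_comp E _; exact: continuous_expR.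
- exact: expR_ge0.
(* As u <= 0, the weighted length is at most the Euclidean one. *)
- rewrite speed ler_piMl//.
  by rewrite -expR0 ler_expR log_conformal_factor_le0.
Qed.

End conformal_factor.

Theorem corollary2p1 (R : realType) (eps : R) (eps_gt0 : 0 < eps) :
  exists (gamma : R -> R * R) (Gamma Omega : set (R * R)) (u : R * R -> R),
    [/\ smooth_jordan_param gamma /\ Gamma = range gamma,
        bounded_component Gamma Omega,
        smooth u /\ (forall p, laplacian u p + expR (2 * u p) <= 0),
        (area_integral setT (fun p => expR (2 * u p)) < +oo)%E &
        (arc_integral gamma (fun p => expR (u p)) ^+ 2 <=
           eps%:E * area_integral Omega (fun p => expR (2 * u p))
                  * area_integral (~` Omega) (fun p => expR (2 * u p)))%E].
Proof.
(* [K] solves eps * (e^(-1) / 4) * (e^(-4) * K) = (2 pi)^2, which equates the bound on the squared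
   length with eps times the product of the two area bounds. *)
pose K := 16 * pi ^+ 2 * (expR (-1))^-1 * (expR (-4))^-1 / eps.
have K0 : 0 <= K by rewrite !mulr_ge0 ?invr_ge0 ?expR_ge0 ?pi_ge0 ?ltW.
(* The largest [a] for which the exterior rectangle of width [K] is admissible; it is at most 1
   because 2 + K >= 2. *)
pose a := ((2 + K) ^+ 2)^-1.
have K2 : 0 < (2 + K) ^+ 2 by rewrite exprn_gt0//; lra.
have a0 : 0 < a by rewrite invr_gt0.
have a1 : a <= 1 by rewrite invf_le1//; nra.
pose u := log_conformal_factor a.
exists (circle 1 (pi *+ 2) 0), [set p : R * R | p.1 ^+ 2 + p.2 ^+ 2 = 1],
  (@unit_disk R), u.
split.
- by split; [exact: smooth_jordan_unit_circle|rewrite range_unit_circle].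
- exact: bounded_component_unit_disk.
- by split; [exact: smooth_diag_quadratic|exact: laplacian_log_conformal_factor].
- exact: conformal_area_lty.
have L0 : (0 <= arc_integral (circle 1 (pi *+ 2) 0) (fun p => expR (u p)))%E.
  by apply: integral_ge0 => t _; rewrite lee_fin mulr_ge0 ?expR_ge0 ?sqrtr_ge0.
have L := conformal_length_unit_circle_le a0.
have A1 := conformal_area_unit_disk_ge a1.
have A2 : ((expR (-4) * K)%:E <=
    area_integral (~` @unit_disk R) (fun p => expR (2 * u p)))%E.
  by apply: conformal_area_exterior_ge => //; rewrite mulVf ?gt_eqF.
(* Squaring the length bound uses [L0], the nonnegativity of the length. *)
apply: (@le_trans _ _ ((pi *+ 2)%:E ^+ 2)%E).
  by rewrite !expe2 lee_pmul.
have -> : ((pi *+ 2)%:E ^+ 2 =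
    eps%:E * (expR (-1) / 4)%:E * (expR (-4) * K)%:E :> \bar R)%E.
  rewrite -EFin_expe -!EFinM mulr2n; congr EFin.
  have := expR_gt0 (-1 : R); have := expR_gt0 (-4 : R) => e4 e1.
  by rewrite /K; field; rewrite !gt_eqF.
have e0 : (0 <= (expR (-1) / 4)%:E :> \bar R)%E.
  by rewrite lee_fin divr_ge0 ?expR_ge0.
(* What remains compares products of nonnegative extended reals factor by factor, using [A1] and
   [A2]. *)
apply: lee_pmul => //.
- by rewrite mule_ge0// lee_fin ltW.
- by rewrite lee_fin mulr_ge0 ?expR_ge0.
- by rewrite lee_pmul// lee_fin ltW.
Qed.
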